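(* Let $\mathfrak{H}$ be a Hilbert space, let $\mathfrak{K}_n$, $n\in\mathbb{N}$, be Hilbert spaces, and let $T_n \in \mathbf{L}(\mathfrak{H},\mathfrak{K}_n)$ be a sequence of linear operators which satisfy $$T_m \prec_c T_n,\quad m\le n.$$ Then there exists a linear operator $T\in\mathbf{L}(\mathfrak{H},\mathfrak{K})$, where $\mathfrak{K}$ is a Hilbert space, such that $$\operatorname{dom} T=\Big\{\varphi\in\bigcap_{n\in\mathbb{N}}\operatorname{dom}T_n:\ \sup_{n\in\mathbb{N}}\|T_n\varphi\|<\infty\Big\}$$ and which satisfies, for all $n \in \mathbb{N}$, $$T_n\prec_c T\quad\text{and}\quad \|T_n\varphi\|\nearrow\|T\varphi\|\ \ (n\to\infty),\quad \varphi\in\operatorname{dom}T.$$ Moreover, the following statements hold: (a) if $T_n$ is closable for all $n\in\mathbb{N}$, then $T$ is closable; (b) if $T_n$ is closed for all $n\in\mathbb{N}$, then $T$ is closed.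
   Context: $\mathbf{L}(\mathfrak{H},\mathfrak{K})$ denotes the class of all linear relations from the Hilbert space $\mathfrak{H}$ to the Hilbert space $\mathfrak{K}$, i.e. all linear subspaces of $\mathfrak{H}\times\mathfrak{K}$; a linear operator is a linear relation $T$ with $\operatorname{mul}T=\{f':\{0,f'\}\in T\}=\{0\}$. Operators are defined on a linear subspace $\operatorname{dom}T\subset\mathfrak{H}$ which need not be dense, and need not be bounded or closed. An operator is closed if its graph is closed, and closable if the closure of its graph is (the graph of) an operator. Contractive domination: for $A\in\mathbf{L}(\mathfrak{H},\mathfrak{H}_A)$ and $B\in\mathbf{L}(\mathfrak{H},\mathfrak{H}_B)$ one writes $A\prec_c B$ if there is a contraction $C\in\mathbf{B}(\mathfrak{H}_B,\mathfrak{H}_A)$ (bounded, everywhere defined, $\|C\|\le1$) with $CB\subset A$, where $CB=\{\{f,Cf'\}:\{f,f'\}\in B\}$. If $A$ and $B$ are linear operators, then $A\prec_c B$ if and only if $\operatorname{dom}B\subset\operatorname{dom}A$ and $\|Af\|\le\|Bf\|$ for all $f\in\operatorname{dom}B$. The symbol $\nearrow$ denotes nondecreasing convergence. *)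

(* Defs.v *)
From HB Require Import structures.
From mathcomp Require Import all_boot all_order all_algebra.
From mathcomp Require Import complex.
From mathcomp Require Import all_classical all_reals all_analysis.

Set Implicit Arguments.
Unset Strict Implicit.
Unset Printing Implicit Defensive.

Import Order.TTheory GRing.Theory Num.Theory numFieldNormedType.Exports.

Local Open Scope classical_set_scope.
Local Open Scope ring_scope.
Local Open Scope complex_scope.

(* Complex Hilbert spaces: [inner] is linear in its first argument, conjugate
   linear in its second argument and positive definite. *)
HB.mixin Record NormedModule_isHilbert (R : realType) (H : Type)
    & NormedModule R[i] H := {
  inner : {dot H for (@Num.conj R[i])};
  inner_normE : forall x : H, `|x| ^+ 2 = inner x x }.

#[short(type="hilbertType")]
HB.structure Definition Hilbert (R : realType) :=
  {H of CompleteNormedModule R[i] H & NormedModule_isHilbert R H}.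

(* The norm of a [normedModType R[i]] takes its values in [R[i]]; this is the
   same norm seen in [R]. *)
Definition hnorm (R : realType) (H : hilbertType R) (x : H) : R :=
  complex.Re `|x|.

Record linear_relation (R : realType) (H K : hilbertType R) := LinearRelation {
  graph : set (H * K);
  graph_submod : GRing.submod_closed [in graph] }.

Section LinearRelations.
Variable R : realType.
Implicit Types H K : hilbertType R.

Definition dom H K (T : linear_relation H K) : set H :=
  [set f | exists f', graph T (f, f')].

Definition mulpart H K (T : linear_relation H K) : set K :=
  [set f' | graph T (0, f')].

Definition is_operator H K (T : linear_relation H K) : Prop :=
  mulpart T = [set 0].

(* For an operator T and f in dom T this is the vector Tf; it is 0 when f is
   not in dom T. *)
Definition ap H K (T : linear_relation H K) (f : H) : K :=
  xget 0 [set f' | graph T (f, f')].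

Definition closed_relation H K (T : linear_relation H K) : Prop :=
  closed (graph T).

Definition closable H K (T : linear_relation H K) : Prop :=
  exists2 S : linear_relation H K,
    graph S = closure (graph T) & is_operator S.

Definition contraction H K (C : {linear H -> K}) : Prop :=
  forall x, `|C x| <= `|x|.

Definition lcomp H K1 K2 (C : {linear K1 -> K2}) (B : linear_relation H K1) :
    set (H * K2) :=
  [set (x.1, C x.2) | x in graph B].

Definition contractively_dominated H HA HB
    (A : linear_relation H HA) (B : linear_relation H HB) : Prop :=
  exists2 C : {linear HB -> HA}, contraction C & lcomp C B `<=` graph A.

End LinearRelations.

Notation "A ≺c B" := (contractively_dominated A B) (at level 70).

(* Main.v *)
From HB Require Import structures.
Require Import Defs.
From mathcomp Require Import all_boot all_order all_algebra.
From mathcomp Require Import complex ring lra.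
From mathcomp Require Import all_classical all_reals all_analysis.

Set Implicit Arguments.
Unset Strict Implicit.
Unset Printing Implicit Defensive.

Import Order.TTheory GRing.Theory Num.Theory numFieldNormedType.Exports.

Local Open Scope classical_set_scope.
Local Open Scope ring_scope.

(** The natural candidate for [T phi] is the whole sequence of the vectors
    [T_n phi]; the proof realizes it as one vector of a Hilbert space that is
    built for this purpose.

    The domination of [T_n] by [T_(n+1)] provides contractions
    [C_n : K_(n+1) -> K_n] with [C_n T_(n+1) phi = T_n phi].  A thread is a
    bounded sequence [x_n] in [K_n] such that [C_n x_(n+1) = x_n].  Along a
    thread the norms [|x_n|] are nondecreasing and bounded, so they converge;
    their limit is a norm on the space of threads.  By polarization the inner
    products of two threads converge as well, hence the norm comes from an inner
    product ([tinner]).  A Cauchy filter of threads converges coordinatewise, and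
    the domination of each coordinate by the limit norm makes the convergence
    uniform in the coordinate ([thread_complete]).  So the threads form a
    Hilbert space.

    Let [T] relate [phi] to a thread [x] when [T_n] relates [phi] to [x_n] for
    all [n].  The sequence [T_n phi] is always linked, so it is a thread exactly
    when its norms are bounded: this is the description of the domain.  The
    coordinate projections are contractions that map [T phi] to [T_n phi], which
    gives the domination, and the convergence of the norms is the definition of
    the norm of a thread.  Finally, the graph of [T] is an intersection of
    preimages of the graphs of the [T_n] under continuous maps, and the
    projections jointly separate the threads: closedness and closability pass
    from the [T_n] to [T] ([thread_relation_closed],
    [thread_relation_closable]). *)

(** * Norms and inner products of Hilbert spaces *)

Section HilbertNorm.
Variables (R : realType) (H : hilbertType R).
Implicit Types (x y : H) (a : R[i]).

Lemma hnormE x : `|x| = (hnorm x)%:C%C.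
Proof. by rewrite /hnorm RRe_real// normr_real. Qed.

Lemma hnorm_ge0 x : 0 <= hnorm x.
Proof. by rewrite -ler0c -hnormE. Qed.

Lemma hnormD x y : hnorm (x + y) <= hnorm x + hnorm y.
Proof. by rewrite -lecR rmorphD /= -!hnormE ler_normD. Qed.

Lemma hnormZ a x : hnorm (a *: x) = complex.Re `|a| * hnorm x.
Proof.
by rewrite {1}/hnorm normrZ hnormE -{1}[`|a|]RRe_real ?normr_real//= mul0r subr0.
Qed.

Lemma hnormN x : hnorm (- x) = hnorm x.
Proof. by rewrite /hnorm normrN. Qed.

Lemma hnorm0 : hnorm (0 : H) = 0.
Proof. by rewrite /hnorm normr0. Qed.

Lemma hnorm_eq0 x : hnorm x = 0 -> x = 0.
Proof. by move=> x0; apply/normr0_eq0; rewrite hnormE x0. Qed.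

Lemma hnorm_inner x : inner x x = (hnorm x ^+ 2)%:C%C.
Proof. by rewrite -inner_normE hnormE rmorphXn. Qed.

Lemma innerC x y : inner x y = (inner y x)^*%C.
Proof.
by have := hermitian_subproof (s := @inner R H) x y; rewrite expr0 mul1r.
Qed.

Lemma Re_innerC x y : complex.Re (inner x y) = complex.Re (inner y x).
Proof. by rewrite innerC; case: (inner y x). Qed.

Lemma Im_innerC x y : complex.Im (inner x y) = - complex.Im (inner y x).
Proof. by rewrite innerC; case: (inner y x). Qed.

(** Polarization: along a sequence, the real parts of the inner products
    converge as soon as the norms of the vectors and of their sums do. *)
Lemma Re_inner x y : complex.Re (inner x y) =
  2^-1 * (hnorm (x + y) ^+ 2 - hnorm x ^+ 2 - hnorm y ^+ 2).
Proof.
have /(congr1 (@complex.Re R)) := hnorm_inner (x + y).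
rewrite /= linearDl !linearDr /= !hnorm_inner [inner y x]innerC => <-.
by case: (inner x y) => a b /=; lra.
Qed.

Lemma Im_inner x y : complex.Im (inner x y) = complex.Re (inner (- 'i%C *: x) y).
Proof.
rewrite linearZl_LR /=; case: (inner x y) => a b /=.
by rewrite oppr0 mul0r sub0r mulN1r opprK.
Qed.

End HilbertNorm.

(** For the linear maps between the spaces of a tower, and for the projections
    of the threads onto these spaces. *)
Lemma contraction_continuous (K : numFieldType) (V W : normedModType K)
    (f : {linear V -> W}) : (forall x, `|f x| <= `|x|) -> continuous f.
Proof.
move=> f_le x; apply/cvgrPdist_lt => e e0; near=> y.
rewrite -raddfB; apply: le_lt_trans (f_le _) _.
by near: y; apply: cvgr_dist_lt.
Unshelve. all: by end_near. Qed.

(** * The module of bounded threads of a tower of contractions *)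

Record tower (R : realType) := Tower {
  space : nat -> hilbertType R;
  link : forall n, {linear space n.+1 -> space n};
  link_contraction : forall n, Defs.contraction (link n) }.

(** An element of the inverse limit of the tower, restricted to the bounded
    sequences in order that the limit of the norms is finite. *)
Record thread (R : realType) (t : tower R) := Thread {
  coord : forall n, space t n;
  coord_link : forall n, link t n (coord n.+1) = coord n;
  coord_bounded : exists M : R, forall n, hnorm (coord n) <= M }.

Section ThreadModule.
Variables (R : realType) (t : tower R).
Implicit Types x y z : thread t.

Lemma threadP x y : (forall n, coord x n = coord y n) -> x = y.
Proof.
case: x y => [x xl xb] [y yl yb] /= xy.
have {}xy : x = y by apply: functional_extensionality_dep.
by subst y; congr Thread; apply: Prop_irrelevance.
Qed.

Fact thread0_link n : link t n 0 = 0. Proof. exact: raddf0. Qed.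
Fact thread0_bounded : exists M : R, forall n, hnorm (0 : space t n) <= M.
Proof. by exists 0 => n; rewrite hnorm0. Qed.
Definition thread0 := Thread thread0_link thread0_bounded.

Fact threadN_link x n : link t n (- coord x n.+1) = - coord x n.
Proof. by rewrite raddfN /= coord_link. Qed.
Fact threadN_bounded x : exists M : R, forall n, hnorm (- coord x n) <= M.
Proof. by have [M xM] := coord_bounded x; exists M => n; rewrite hnormN. Qed.
Definition threadN x := Thread (threadN_link x) (threadN_bounded x).

Fact threadD_link x y n :
  link t n (coord x n.+1 + coord y n.+1) = coord x n + coord y n.
Proof. by rewrite raddfD /= !coord_link. Qed.
Fact threadD_bounded x y :
  exists M : R, forall n, hnorm (coord x n + coord y n) <= M.
Proof.
have [M xM] := coord_bounded x; have [N yN] := coord_bounded y.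
by exists (M + N) => n; rewrite (le_trans (hnormD _ _)) ?lerD.
Qed.
Definition threadD x y := Thread (threadD_link x y) (threadD_bounded x y).

Fact threadZ_link (a : R[i]) x n :
  link t n (a *: coord x n.+1) = a *: coord x n.
Proof. by rewrite linearZ /= coord_link. Qed.
Fact threadZ_bounded (a : R[i]) x :
  exists M : R, forall n, hnorm (a *: coord x n) <= M.
Proof.
have [M xM] := coord_bounded x; exists (complex.Re `|a| * M) => n.
by rewrite hnormZ ler_wpM2l// -ler0c RRe_real ?normr_real.
Qed.
Definition threadZ a x := Thread (threadZ_link a x) (threadZ_bounded a x).

HB.instance Definition _ := gen_eqMixin (thread t).
HB.instance Definition _ := gen_choiceMixin (thread t).

Fact threadDA : associative threadD.
Proof. by move=> x y z; apply: threadP => n /=; rewrite addrA. Qed.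
Fact threadDC : commutative threadD.
Proof. by move=> x y; apply: threadP => n /=; rewrite addrC. Qed.
Fact thread0D : left_id thread0 threadD.
Proof. by move=> x; apply: threadP => n /=; rewrite add0r. Qed.
Fact threadND : left_inverse thread0 threadN threadD.
Proof. by move=> x; apply: threadP => n /=; rewrite addNr. Qed.
HB.instance Definition _ :=
  GRing.isZmodule.Build (thread t) threadDA threadDC thread0D threadND.

Fact threadZA a b x : threadZ a (threadZ b x) = threadZ (a * b) x.
Proof. by apply: threadP => n /=; rewrite scalerA. Qed.
Fact thread1Z : left_id 1 threadZ.
Proof. by move=> x; apply: threadP => n /=; rewrite scale1r. Qed.
Fact threadZDr : right_distributive threadZ +%R.
Proof. by move=> a x y; apply: threadP => n /=; rewrite scalerDr. Qed.
Fact threadZDl x a b : threadZ (a + b) x = threadZ a x + threadZ b x.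
Proof. by apply: threadP => n /=; rewrite scalerDl. Qed.
HB.instance Definition _ := GRing.Zmodule_isLmodule.Build R[i] (thread t)
  threadZA thread1Z threadZDr threadZDl.

(** The coordinates again, as a function of the thread, so that it can carry a
    linear structure. *)
Definition proj n x : space t n := coord x n.

Fact proj_linear n : linear (proj n). Proof. by []. Qed.
HB.instance Definition _ n :=
  GRing.isLinear.Build R[i] (thread t) (space t n) _ (proj n) (proj_linear n).

End ThreadModule.

(** * The norm of a thread and completeness *)

Section ThreadNorm.
Variables (R : realType) (t : tower R).
Implicit Types x y z : thread t.

Definition tnorm x : R := limn (fun n => hnorm (coord x n)).

Lemma coord_nondecreasing x : nondecreasing_seq (fun n => hnorm (coord x n)).
Proof.
apply/nondecreasing_seqP => n.
by rewrite -lecR -!hnormE -[coord x n]coord_link link_contraction.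
Qed.

Lemma is_cvg_tnorm x : cvgn (fun n => hnorm (coord x n)).
Proof.
have [M xM] := coord_bounded x.
apply: (nondecreasing_is_cvgn (coord_nondecreasing x)).
by exists M => _ [n _ <-].
Qed.

Lemma cvg_tnorm x : hnorm (coord x n) @[n --> \oo] --> tnorm x.
Proof. exact: is_cvg_tnorm. Qed.

Lemma coord_le_tnorm x n : hnorm (coord x n) <= tnorm x.
Proof.
exact: (nondecreasing_cvgn_le (coord_nondecreasing x) (@is_cvg_tnorm x)).
Qed.

Lemma tnorm_le x M : (forall n, hnorm (coord x n) <= M) -> tnorm x <= M.
Proof.
move=> xM; apply: limr_le; first exact: is_cvg_tnorm.
exact: nearW.
Qed.

Fact tnormD x y : ((tnorm (x + y))%:C <= (tnorm x)%:C + (tnorm y)%:C)%C.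
Proof.
rewrite -rmorphD lecR; apply: tnorm_le => n.
by rewrite (le_trans (hnormD _ _))// lerD// coord_le_tnorm.
Qed.

Fact tnormZ (a : R[i]) x : ((tnorm (a *: x))%:C = `|a| * (tnorm x)%:C)%C.
Proof.
rewrite -[`|a|]RRe_real ?normr_real// -rmorphM; congr (_%:C)%C.
apply/cvg_lim => //=; under eq_fun do rewrite hnormZ.
by apply: cvgM; [exact: cvg_cst|exact: cvg_tnorm].
Qed.

Fact tnorm_eq0 x : ((tnorm x)%:C = 0)%C -> x = 0.
Proof.
move=> [x0]; apply: threadP => n; apply: hnorm_eq0.
by apply/eqP; rewrite eq_le hnorm_ge0 -x0 coord_le_tnorm.
Qed.

HB.instance Definition _ :=
  Lmodule_isNormed.Build R[i] (thread t) tnormD tnormZ tnorm_eq0.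

Lemma thread_normE x : `|x| = ((tnorm x)%:C)%C.
Proof. by []. Qed.

Lemma proj_contraction n x : `|proj n x| <= `|x|.
Proof. by rewrite hnormE thread_normE lecR coord_le_tnorm. Qed.

Lemma thread_norm_le x (e : R[i]) : 0 <= e ->
  (forall n, `|coord x n| <= e) -> `|x| <= e.
Proof.
move=> /ger0_real /RRe_real <- xe; rewrite thread_normE lecR.
by apply: tnorm_le => n; rewrite -lecR -hnormE.
Qed.

Lemma proj_continuous n : continuous (@proj R t n).
Proof. exact: contraction_continuous (proj_contraction n). Qed.

(** Each coordinate of a Cauchy filter converges because the projections are
    contractions.  The distance in a coordinate from the limit to a point whose
    ball belongs to the filter has a bound that does not depend on the
    coordinate, so it passes to the limit norm. *)
Fact thread_complete (F : set_system (thread t)) :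
  ProperFilter F -> cauchy F -> cvg F.
Proof.
move=> FF /cauchyP Fc.
have cvg_coord n : cvg (proj n @ F).
  apply: cauchy_cvg; apply: cauchy_exP => e /Fc[x Fx]; exists (coord x n).
  move: Fx; apply: (@filterS _ F) => z; rewrite /= -!ball_normE /=.
  exact: le_lt_trans (proj_contraction n (x - z)).
pose y n : space t n := lim (proj n @ F).
(* The order on the complex numbers is partial, which makes limits of
   inequalities inconvenient: a point z of the filter that approximates y in the
   n-th coordinate replaces the passage to the limit, at the cost of a second
   e. *)
have y_near x (e : R[i]) : 0 < e -> F (ball x e) ->
    forall n, `|y n - coord x n| <= e + e.
  move=> e0 Fx n; near F => z.
  have -> : y n - coord x n = (y n - proj n z) + (coord z n - coord x n).
    by rewrite addrA subrK.
  rewrite (le_trans (ler_normD _ _))// lerD//.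
    by near: z; move/cvgrPdist_le: (cvg_coord n); apply.
  rewrite (le_trans (proj_contraction n (z - x)))// distrC ltW//.
  by near: z; move: Fx; rewrite -ball_normE.
have y_link n : link t n (y n.+1) = y n.
  apply/esym/cvg_lim; first exact: norm_hausdorff.
  have -> : proj n = link t n \o @proj R t n.+1.
    by apply/funext => x; rewrite /proj /= coord_link.
  apply: cvg_comp; first exact: cvg_coord.
  exact: contraction_continuous (@link_contraction _ t n) _.
have y_bounded : exists M : R, forall n, hnorm (y n) <= M.
  have [x Fx] := Fc 1 ltr01; exists (tnorm x + 2) => n.
  rewrite -[y n](subrK (coord x n)) (le_trans (hnormD _ _))// addrC lerD//.
    exact: coord_le_tnorm.
  by rewrite -lecR -hnormE rmorph_nat mulr2n y_near.
apply/cvg_ex; exists (Thread y_link y_bounded).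
apply/cvgrPdist_le => e e0.
have e3 : 0 < e / 3 by rewrite divr_gt0.
have [x Fx] := Fc _ e3.
near=> z; rewrite -(subrK x (Thread _ _)) -addrA (le_trans (ler_normD _ _))//.
have -> : e = (e / 3 + e / 3) + e / 3 by field.
rewrite lerD//.
  apply: thread_norm_le => [|n]; first by rewrite addr_ge0 ?ltW.
  exact: y_near e3 Fx n.
by rewrite ltW//; near: z; move: Fx; rewrite -ball_normE.
Unshelve. all: by end_near. Qed.
HB.instance Definition _ := Uniform_isComplete.Build (thread t) thread_complete.

End ThreadNorm.

(** * The inner product of threads *)

Section ThreadInner.
Variables (R : realType) (t : tower R).
Implicit Types x y z : thread t.

(** Limit of the inner products of the coordinates.  It is taken separately in
    the real and in the imaginary part, where the limits are those of real
    sequences. *)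
Definition tinner x y : R[i] :=
  Complex (limn (fun n => complex.Re (inner (coord x n) (coord y n))))
          (limn (fun n => complex.Im (inner (coord x n) (coord y n)))).

(** Polarization reduces this to the norms of [x + y], [x] and [y], which
    converge because a sum of threads is a thread. *)
Lemma is_cvg_Re_inner x y :
  cvgn (fun n => complex.Re (inner (coord x n) (coord y n))).
Proof.
under eq_fun do rewrite Re_inner.
have cvg_sqr z : cvgn (fun n => hnorm (coord z n) ^+ 2).
  by under eq_fun do rewrite expr2; apply: is_cvgM; exact: is_cvg_tnorm.
apply: is_cvgMr; apply: is_cvgB; last exact: cvg_sqr.
by apply: is_cvgB; [exact: (cvg_sqr (x + y))|exact: cvg_sqr].
Qed.

(** The imaginary part for [x] is the real part for the thread [- 'i *: x]. *)
Lemma is_cvg_Im_inner x y :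
  cvgn (fun n => complex.Im (inner (coord x n) (coord y n))).
Proof.
under eq_fun do rewrite Im_inner.
exact: (@is_cvg_Re_inner (- 'i%C *: x) y).
Qed.

Lemma tinner_cvg x y a b :
    complex.Re (inner (coord x n) (coord y n)) @[n --> \oo] --> a ->
    complex.Im (inner (coord x n) (coord y n)) @[n --> \oo] --> b ->
  tinner x y = Complex a b.
Proof. by move=> xya xyb; congr Complex; apply/cvg_lim. Qed.

Fact tinner_hermitian x y :
  tinner x y = (-1) ^+ false * Num.conj (tinner y x).
Proof.
rewrite expr0 mul1r; apply: tinner_cvg.
  under eq_fun do rewrite Re_innerC.
  exact: is_cvg_Re_inner.
under eq_fun do rewrite Im_innerC.
by apply: cvgN; exact: is_cvg_Im_inner.
Qed.

Lemma tinner_linearl z (a : R[i]) x y :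
  tinner (a *: x + y) z = a * tinner x z + tinner y z.
Proof.
case: a => a b; apply: tinner_cvg.
  under eq_fun => n.
    rewrite linearDl linearZl_LR /=.
    rewrite (_ : complex.Re _ =
      a * complex.Re (inner (coord x n) (coord z n)) -
      b * complex.Im (inner (coord x n) (coord z n)) +
      complex.Re (inner (coord y n) (coord z n))); last first.
      by case: (inner (coord x n) _) => ? ?; case: (inner (coord y n) _).
    over.
  apply: cvgD; last exact: is_cvg_Re_inner.
  apply: cvgB; apply: cvgM; try exact: cvg_cst.
    exact: is_cvg_Re_inner.
  exact: is_cvg_Im_inner.
under eq_fun => n.
  rewrite linearDl linearZl_LR /=.
  rewrite (_ : complex.Im _ =
    a * complex.Im (inner (coord x n) (coord z n)) +
    b * complex.Re (inner (coord x n) (coord z n)) +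
    complex.Im (inner (coord y n) (coord z n))); last first.
    by case: (inner (coord x n) _) => ? ?; case: (inner (coord y n) _).
  over.
apply: cvgD; last exact: is_cvg_Im_inner.
apply: cvgD; apply: cvgM; try exact: cvg_cst.
  exact: is_cvg_Im_inner.
exact: is_cvg_Re_inner.
Qed.

Fact tinner_zmodl z : zmod_morphism (tinner ^~ z).
Proof.
move=> x y /=.
by rewrite -scaleN1r addrC tinner_linearl mulN1r addrC.
Qed.

Fact tinner_scalablel z : scalable_for *%R (tinner ^~ z).
Proof.
move=> a x /=.
have tinner0 : tinner 0 z = 0 by rewrite -(subrr 0) tinner_zmodl subrr.
by rewrite -[a *: x]addr0 tinner_linearl tinner0 addr0.
Qed.

Fact tinner_zmodr x : zmod_morphism (tinner x).
Proof.
move=> y z; rewrite !(tinner_hermitian x) !expr0 !mul1r.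
by rewrite tinner_zmodl rmorphB.
Qed.

Fact tinner_scalabler x : scalable_for (Num.conj \; *%R) (tinner x).
Proof.
move=> a y; rewrite !(tinner_hermitian x) !expr0 !mul1r.
by rewrite tinner_scalablel rmorphM.
Qed.

Fact tinner_normE x : `|x| ^+ 2 = tinner x x.
Proof.
rewrite thread_normE -rmorphXn; apply/esym/tinner_cvg.
  under eq_fun do rewrite hnorm_inner /= expr2.
  by apply: cvgM; exact: cvg_tnorm.
by under eq_fun do rewrite hnorm_inner /=; exact: cvg_cst.
Qed.

Fact tinner_gt0 x : x != 0 -> 0 < tinner x x.
Proof. by rewrite -tinner_normE -normr_gt0; exact: exprn_gt0. Qed.

HB.instance Definition _ := isBilinear.Build R[i] (thread t) (thread t) R[i]
  *%R (Num.conj \; *%R) tinner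
  tinner_zmodl tinner_zmodr tinner_scalablel tinner_scalabler.
HB.instance Definition _ := isHermitianSesquilinear.Build R[i] (thread t)
  false Num.conj tinner tinner_hermitian.
HB.instance Definition _ :=
  isDotProduct.Build R[i] (thread t) tinner tinner_gt0.

HB.instance Definition _ :=
  NormedModule_isHilbert.Build R (thread t) tinner_normE.

End ThreadInner.

(** * Linear relations and their closures *)

Section RelationTheory.
Variables (R : realType) (H K : hilbertType R).
Implicit Types T S : linear_relation H K.

Lemma graph0 T : graph T (0, 0).
Proof. by have [+ _] := graph_submod T; rewrite inE. Qed.

Lemma graphP T (a : R[i]) p q :
  graph T p -> graph T q -> graph T (a *: p + q).
Proof.
move=> Tp Tq; have [_ Tlin] := graph_submod T.
by have := Tlin a p q; rewrite !inE; apply.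
Qed.

Lemma is_operatorP T :
  is_operator T <-> forall g, graph T (0, g) -> g = 0.
Proof.
split=> [Top g Tg|Top]; first by have : mulpart T g by []; rewrite Top.
by apply/seteqP; split=> [g /Top//|_ ->]; exact: graph0.
Qed.

Lemma operator_inj T f g h : is_operator T ->
  graph T (f, g) -> graph T (f, h) -> g = h.
Proof.
move=> /is_operatorP Top Tg Th; apply/eqP; rewrite -subr_eq0; apply/eqP/Top.
have := graphP (-1) Th Tg.
by rewrite scaleN1r addrC -[(f, g) - _]/(f - f, g - h) subrr.
Qed.

Lemma graph_ap T f : dom T f -> graph T (f, ap T f).
Proof.
by move=> [g Tg]; apply: (@xgetPex _ 0 [set g' | graph T (f, g')]); exists g.
Qed.

Lemma ap_graph T f g : is_operator T -> graph T (f, g) -> ap T f = g.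
Proof.
by move=> Top Tg; apply: (operator_inj Top) (Tg); apply: graph_ap; exists g.
Qed.

Lemma closure_submod T : GRing.submod_closed [in closure (graph T)].
Proof.
split=> [|a p q]; rewrite !inE.
  by apply: subset_closure; exact: graph0.
move=> clp clq B.
have /(_ (p, q)) : continuous (fun z : (H * K) * (H * K) => a *: z.1 + z.2).
  move=> z; apply: cvgD; last exact: cvg_snd.
  by apply: cvgZr; exact: cvg_fst.
move=> /[apply] -[[P Q] /= [Pp Qq] PQB].
have [p' [Tp' Pp']] := clp _ Pp; have [q' [Tq' Qq']] := clq _ Qq.
exists (a *: p' + q'); split; first exact: graphP.
exact: (PQB (p', q')).
Qed.

(** Since the closure of a linear relation is a linear relation, closability
    only concerns the vectors that the closure relates to 0. *)
Lemma closableP T :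
  closable T <-> forall g, closure (graph T) (0, g) -> g = 0.
Proof.
split=> [[S <- /is_operatorP//]|Tcl].
by exists (LinearRelation (@closure_submod T)) => //; apply/is_operatorP.
Qed.

End RelationTheory.

(** * The relation with values in the threads *)

Section ThreadRelation.
Variables (R : realType) (H : hilbertType R) (t : tower R).
Variable A : forall n, linear_relation H (space t n).

Definition thread_graph : set (H * thread t) :=
  [set p | forall n, graph (A n) (p.1, coord p.2 n)].

Fact thread_graph_submod : GRing.submod_closed [in thread_graph].
Proof.
split=> [|a p q]; rewrite !inE; first by move=> n; exact: graph0.
by move=> Ap Aq n; exact: graphP (Ap n) (Aq n).
Qed.

Definition thread_relation := LinearRelation thread_graph_submod.

Lemma thread_relation_operator :
  (forall n, is_operator (A n)) -> is_operator thread_relation.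
Proof.
move=> Aop; apply/is_operatorP => x Ax; apply: threadP => n.
by have /is_operatorP := Aop n; apply; exact: Ax.
Qed.

Lemma thread_relation_dominates n : A n ≺c thread_relation.
Proof.
exists (@proj R t n); first by move=> x; exact: proj_contraction.
by move=> _ [[f x] Ax <-]; exact: Ax.
Qed.

(** Such a set is an intersection of preimages under the continuous maps
    [(f, x) |-> (f, x_n)].  The sets [F n] are arbitrary because the graphs are
    used for closedness and their closures for closability. *)
Lemma thread_graph_closed (F : forall n, set (H * space t n)) :
  (forall n, closed (F n)) ->
  closed [set p : H * thread t | forall n, F n (p.1, coord p.2 n)].
Proof.
move=> Fcl; rewrite (_ : [set p | _] =
  \bigcap_n (fun p : H * thread t => (p.1, proj n p.2)) @^-1` F n).
  apply: closed_bigI => n _; apply: closed_comp (Fcl n) => p _.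
  apply: cvg_pair => /=; first exact: cvg_fst.
  by apply: cvg_comp; [exact: cvg_snd|exact: proj_continuous].
by apply/seteqP; split=> p Fp n; [move=> _; exact: Fp|exact: (Fp n I)].
Qed.

Lemma thread_relation_closed :
  (forall n, closed_relation (A n)) -> closed_relation thread_relation.
Proof. exact: thread_graph_closed. Qed.

(** A thread related to 0 in the closure has coordinates related to 0 in the
    closures of the [A n], so all its coordinates vanish. *)
Lemma thread_relation_closable :
  (forall n, closable (A n)) -> closable thread_relation.
Proof.
move=> Acl; apply/closableP => x clx.
pose F := [set p : H * thread t |
  forall n, closure (graph (A n)) (p.1, coord p.2 n)].
have /closure_id F_closed : closed F.
  apply: (@thread_graph_closed (fun n => closure (graph (A n)))) => n.
  exact: closed_closure.
have Fx : F (0, x).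
  rewrite F_closed; apply: closure_subset clx => p Ap n.
  exact/subset_closure/Ap.
by apply: threadP => n; have /closableP := Acl n; apply; exact: Fx.
Qed.

End ThreadRelation.

(** * The limit operator *)

Theorem theorem5p1 (R : realType) (H : hilbertType R)
    (K_ : nat -> hilbertType R) (T_ : forall n, linear_relation H (K_ n))
    (T_op : forall n, is_operator (T_ n))
    (T_dom : forall m n, (m <= n)%N -> T_ m ≺c T_ n) :
  exists (K : hilbertType R) (T : linear_relation H K),
    [/\ is_operator T,
        dom T = [set phi | (\bigcap_n dom (T_ n)) phi /\
          (ereal_sup (range (fun n => (hnorm (ap (T_ n) phi))%:E)) < +oo)%E],
        forall n, T_ n ≺c T &
        forall phi, dom T phi ->
          nondecreasing_seq (fun n => hnorm (ap (T_ n) phi)) /\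
          hnorm (ap (T_ n) phi) @[n --> \oo] --> hnorm (ap T phi)] /\
    ((forall n, closable (T_ n)) -> closable T) /\
    ((forall n, closed_relation (T_ n)) -> closed_relation T).
Proof.
have C n := cid2 (T_dom n n.+1 (leqnSn n)).
pose t := Tower (fun n => s2valP (C n)).
pose T := @thread_relation R H t T_.
have T_op' : is_operator T by exact: (@thread_relation_operator R H t T_).
exists (thread t), T; split; last first.
  split; first exact: (@thread_relation_closable R H t T_).
  exact: (@thread_relation_closed R H t T_).
have coord_ap phi x n : graph T (phi, x) -> ap (T_ n) phi = coord x n.
  by move=> Tx; apply: ap_graph; [exact: T_op|exact: Tx].
split=> // [|n|phi [x Tx]].
- apply/seteqP; split=> phi.
    move=> [x Tx]; split=> [n _|]; first by exists (coord x n); exact: Tx.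
    apply: (@le_lt_trans _ _ (tnorm x)%:E); last exact: ltry.
    apply: ge_ereal_sup => _ [n _ <-].
    by rewrite lee_fin (coord_ap _ _ n Tx) coord_le_tnorm.
  move=> [phi_dom phi_sup].
  have ap_link n : link t n (ap (T_ n.+1) phi) = ap (T_ n) phi.
    apply/esym/ap_graph; first exact: T_op.
    apply: (s2valP' (C n)); exists (phi, ap (T_ n.+1) phi) => //.
    exact/graph_ap/phi_dom.
  have ap_bounded : exists M : R, forall n, hnorm (ap (T_ n) phi) <= M.
    (* The supremum is a real number: it is not +oo by hypothesis, and it is not
       -oo because it is at least the norm of index 0. *)
    have ub n := ereal_sup_ubound (imageT
      (fun n => (hnorm (ap (T_ n) phi))%:E) n).
    move: phi_sup ub; case: ereal_sup => [M _|//|_] ub.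
      by exists M => n; have := ub n; rewrite lee_fin.
    by have := ub 0%N.
  exists (Thread (t := t) ap_link ap_bounded) => n.
  exact/graph_ap/phi_dom.
- exact: (@thread_relation_dominates R H t T_).
- rewrite (ap_graph T_op' Tx).
  have -> : (fun n => hnorm (ap (T_ n) phi)) = (fun n => hnorm (coord x n)).
    by apply/funext => n; rewrite (coord_ap _ _ n Tx).
  by split; [exact: coord_nondecreasing|exact: cvg_tnorm].
Qed.
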